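(* Let $C_n(a,b)$ be a connected $2$-regular circulant digraph (so $\gcd(n,a,b)=1$) and let $l\ge1$. Then the number of primitive periodic orbits of length $l$ is $$|\mathcal{P}_l(C_n(a,b))|=\frac{n}{l}\sum_{\omega=\lceil la/n\rceil}^{\lfloor lb/n\rfloor}\ \sum_{m\mid\omega}\mu(m)\binom{l/m}{k_\omega/m},$$ where $k_\omega=(\omega n-la)/(b-a)$, $\mu$ is the Möbius function, and $\binom{x}{y}$ is interpreted as $0$ unless both $x$ and $y$ are nonnegative integers.
   Context: Let $n\ge 2$ and $0<a<b<n$ be integers. The directed circulant graph $C_n(a,b)$ has vertex set $\mathbb{Z}_n$ and directed bonds $(v,v+a)$ and $(v,v+b)$ for each $v\in\mathbb{Z}_n$ (addition mod $n$); the bond $(v,v+s)$ has step size $s\in\{a,b\}$. It is (strongly) connected iff $\gcd(n,a,b)=1$. A path of length $l$ is a sequence of bonds $(e_1,\dots,e_l)$ where the terminus of $e_j$ is the origin of $e_{j+1}$. A circuit is a path whose last terminus equals its first origin. A periodic orbit is an equivalence class of circuits under cyclic rotation $\sigma(e_1,\dots,e_l)=(e_2,\dots,e_l,e_1)$. For a circuit $c$, $c^r$ denotes the concatenation of $r$ copies of $c$. A periodic orbit $p$ is primitive if there is no circuit $c_0$ and integer $r>1$ with $p=[c_0^r]$. $\mathcal{P}_l(C_n(a,b))$ denotes the set of primitive periodic orbits of length $l$. *)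

(* Defs.v *)
From mathcomp Require Import all_boot all_order all_algebra.
From mathcomp Require Import boolp.
Set Implicit Arguments. Unset Strict Implicit. Unset Printing Implicit Defensive.
Import Order.TTheory GRing.Theory Num.Theory.

(* Vertices of C_n(a,b) are 'I_n (= Z_n, addition mod n).  A directed bond
   is an ordered pair (origin, terminus) = (v, v + s mod n) with s in {a,b}. *)
Definition bondT (n : nat) := ('I_n * 'I_n)%type.

Definition is_bond (n a b : nat) (e : bondT n) : bool :=
  (val e.2 == (val e.1 + a) %% n) || (val e.2 == (val e.1 + b) %% n).

Definition is_circuit (n a b : nat) (c : seq (bondT n)) : bool :=
  match c with
  | [::] => false
  | e0 :: s => all (is_bond a b) c
               && path (fun e f : bondT n => e.2 == f.1) e0 s
               && ((last e0 s).2 == e0.1)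
  end.

Definition orbit_of (n l : nat) (c : seq (bondT n)) : {set l.-tuple (bondT n)} :=
  [set d : l.-tuple (bondT n) | [exists i : 'I_l, val d == rot i c]].

Definition cpow (T : Type) (c : seq T) (r : nat) : seq T := flatten (nseq r c).

Definition primitive_orbit (n a b l : nat) (p : {set l.-tuple (bondT n)}) : Prop :=
  ~ (exists (c0 : seq (bondT n)) (r : nat),
        is_circuit a b c0 /\ 1 < r /\ p = orbit_of l (cpow c0 r)).

Definition prim_orbits (n a b l : nat) : {set {set l.-tuple (bondT n)}} :=
  [set p : {set l.-tuple (bondT n)} |
     [exists c : l.-tuple (bondT n), is_circuit a b c && (p == orbit_of l c)]
     && `[< primitive_orbit a b p >]].

Definition squarefree (m : nat) : bool := all (fun p => logn p m == 1) (primes m).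
Definition mobius (m : nat) : int :=
  if (0 < m) && squarefree m then ((-1) ^+ size (primes m))%R else 0%R.

Definition is_natQ (q : rat) : bool := (denq q == 1) && (0 <= numq q)%R.
Definition binomQ (x y : rat) : nat :=
  if is_natQ x && is_natQ y then 'C(absz (numq x), absz (numq y)) else 0.

Definition ceil_div (x y : nat) : nat := (x + y - 1) %/ y.

Local Open Scope ring_scope.
Definition k_omega (n a b l w : nat) : rat :=
  ((w * n)%:R - (l * a)%:R) / ((b%:R : rat) - a%:R).

Definition prim_count_formula (n a b l : nat) : rat :=
  (n%:R / l%:R) *
  \sum_(ceil_div (l * a) n <= w < ((l * b) %/ n).+1)
     \sum_(m <- divisors w)
        (mobius m)%:~R * (binomQ (l%:R / m%:R) (k_omega n a b l w / m%:R))%:R.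

(* Main.v *)
(* Rotation by one step acts on the circuits of length l, and the period of a
   circuit under this action divides l; a periodic orbit is primitive exactly
   when its circuits have period l, in which case it consists of l circuits.
   The identity sum_{d | n} mu(d) = [n = 1] selects the circuits of period l, so
   that l |P_l| = sum_{m | l} mu(m) #{circuits fixed by rotation by l/m}, and a
   circuit fixed by rotation by l/m is the m-th power of a circuit of length l/m.
   A circuit of length l is a starting vertex together with a word in the two
   steps whose total displacement la + k(b-a) is a multiple of n, k being the
   number of steps b. Writing this multiple as w n, where w is the winding number
   of the circuit, and exchanging the sums over m and w gives the formula. *)
Require Import Defs.
From mathcomp Require Import all_boot all_order all_algebra.
From mathcomp Require Import boolp zify.
Set Implicit Arguments. Unset Strict Implicit. Unset Printing Implicit Defensive.
Import GRing.Theory Num.Theory.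

(** * The Möbius function and its sum over divisors *)

(** When [p] divides [d], its exponent in [p * d] exceeds 1; otherwise [p * d] has exactly one more
    prime factor than [d], which flips the sign. *)
Lemma mobius_prime_mul p d : prime p -> 0 < d ->
  mobius (p * d) = if p %| d then 0%R else (- mobius d)%R.
Proof.
move=> p_pr d_gt0; have p_gt0 := prime_gt0 p_pr.
rewrite /mobius muln_gt0 p_gt0 d_gt0 /=; have [p_d | pNd] := boolP (p %| d).
  rewrite ifF //; apply/negbTE/negP => /allP/(_ p).
  rewrite primesM // !mem_primes !p_pr d_gt0 p_d orbT => /(_ isT).
  rewrite lognM // logn_prime // eqxx /= add1n eqSS.
  by rewrite -leqn0 leqNgt logn_gt0 mem_primes p_pr d_gt0 p_d.
have p_primes : p \notin primes d by rewrite mem_primes p_pr d_gt0.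
have pdE : perm_eq (primes (p * d)) (p :: primes d).
  apply: uniq_perm; rewrite /= ?p_primes ?primes_uniq // => q.
  by rewrite primesM // primes_prime // !inE.
rewrite (perm_size pdE) /= exprS mulN1r /squarefree (perm_all _ pdE) /=.
rewrite lognM // logn_prime // eqxx (lognE p d) p_pr d_gt0 (negPf pNd) /=.
rewrite (@eq_in_all _ _ (fun q => logn q d == 1)); last first.
  move=> q q_d; rewrite lognM // logn_prime //.
  by have [pq | //] := eqVneq q p; rewrite -pq q_d in p_primes.
by case: ifP => _; rewrite ?oppr0.
Qed.

(** For [p] the least prime factor of [n > 1], the divisors prime to [p] are those of [n %/ p] prime
    to [p], and the others are [p * d] with [d] dividing [n %/ p]. The terms at [p * d] vanish if
    [p] divides [d] and cancel the term at [d] otherwise. *)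
Lemma sum_mobius n : 0 < n ->
  (\sum_(d <- divisors n) mobius d)%R = (n == 1)%:R%R.
Proof.
move=> n_gt0; have [-> | n_neq1] := eqVneq n 1.
  by rewrite (_ : divisors 1 = [:: 1]) // big_seq1.
have p_pr : prime (pdiv n) by apply: pdiv_prime; lia.
set p := pdiv n in p_pr; have p_gt0 := prime_gt0 p_pr.
have p_n : p %| n := pdiv_dvd n.
have q_gt0 : 0 < n %/ p by rewrite divn_gt0 // dvdn_leq.
have multE : perm_eq [seq d <- divisors n | p %| d]
    [seq p * d | d <- divisors (n %/ p)].
  apply: uniq_perm; first by rewrite filter_uniq ?divisors_uniq.
    rewrite map_inj_uniq ?divisors_uniq // => x y /eqP.
    by rewrite eqn_pmul2l // => /eqP.
  move=> d; rewrite mem_filter -dvdn_divisors //; apply/andP/mapP.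
    case=> /dvdnP[e ->]; rewrite mulnC => pe_n; exists e => //.
    by rewrite -dvdn_divisors // dvdn_divRL // mulnC.
  case=> e; rewrite -dvdn_divisors // dvdn_divRL // => e_n ->.
  by rewrite dvdn_mulr // mulnC.
have coprE : perm_eq [seq d <- divisors n | ~~ (p %| d)]
    [seq d <- divisors (n %/ p) | ~~ (p %| d)].
  apply: uniq_perm; rewrite ?filter_uniq ?divisors_uniq // => d.
  rewrite !mem_filter -!dvdn_divisors //; case: (boolP (p %| d)) => //= pNd.
  by rewrite -{1}(divnK p_n) Gauss_dvdl // coprime_sym prime_coprime.
rewrite (bigID (fun d => p %| d)) /= -!(big_filter _ (fun d => _ (p %| d))) /=.
rewrite -big_filter (perm_big _ multE) (perm_big _ coprE) /= big_map big_filter.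
rewrite (eq_big_seq (fun d => if (p %| d)%N then 0 else - mobius d)%R); last first.
  by move=> d d_n; rewrite mobius_prime_mul // (dvdn_gt0 q_gt0) // dvdn_divisors.
rewrite (bigID (fun d => p %| d)) /= big1 ?add0r => [|d ->//].
rewrite -big_split big1 // => d pNd.
by rewrite /= (negPf pNd) addNr.
Qed.

(** * Periods of points under an injective map *)

Lemma iter_order_dvdn (T : finType) (f : T -> T) (x : T) k : injective f ->
  (iter k f x == x) = (order f x %| k).
Proof.
move=> f_inj.
have period q : iter (q * order f x) f x = x.
  by elim: q => // q IHq; rewrite mulSn iterD IHq iter_order.
apply/eqP/idP => [| /dvdnP[q ->]//].
rewrite {1}(divn_eq k (order f x)) addnC iterD period => fx.
have r_lt : k %% order f x < order f x by rewrite ltn_mod order_gt0.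
by rewrite /dvdn -(findex_iter r_lt) fx findex0.
Qed.

(** Let [o] be the period of [x]. The iterate [l %/ m] fixes [x] exactly when [o] divides [l %/ m],
    that is when [m] divides [l %/ o], so the sum is the Möbius sum over the divisors of
    [l %/ o]. *)
Lemma sum_mobius_fixed (T : finType) (f : T -> T) (x : T) l :
  injective f -> 0 < l -> iter l f x = x ->
  (\sum_(m <- divisors l | iter (l %/ m) f x == x) mobius m)%R
    = (order f x == l)%:R%R.
Proof.
move=> f_inj l_gt0 /eqP; rewrite iter_order_dvdn // => o_l.
have o_gt0 := order_gt0 f x; set o := order f x in o_l o_gt0 *.
have lo_gt0 : 0 < l %/ o by rewrite divn_gt0 // dvdn_leq.
rewrite (_ : (o == l) = (l %/ o == 1)).
  rewrite -sum_mobius // -big_filter; apply: perm_big.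
  apply: uniq_perm; rewrite ?filter_uniq ?divisors_uniq // => m.
  rewrite mem_filter -!dvdn_divisors // iter_order_dvdn // -/o.
  apply/andP/idP => [[o_lm m_l] | m_lo].
    by rewrite dvdn_divRL // mulnC -dvdn_divRL.
  have m_l : m %| l by rewrite (dvdn_trans m_lo) // dvdn_div.
  by rewrite m_l dvdn_divRL // mulnC -dvdn_divRL.
by rewrite -[RHS](eqn_pmul2r o_gt0) divnK // mul1n eq_sym.
Qed.

(** * Powers of words and of circuits *)

Lemma size_cpow (T : Type) (c : seq T) r : size (cpow c r) = r * size c.
Proof. by elim: r => // r IHr; rewrite /cpow /= size_cat -/(cpow c r) IHr. Qed.

Lemma take_cpow (T : Type) (c : seq T) r :
  0 < r -> take (size c) (cpow c r) = c.
Proof. by case: r => // r _; rewrite /cpow /= take_size_cat. Qed.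

Lemma rot_cpow (T : Type) (c : seq T) r : rot (size c) (cpow c r) = cpow c r.
Proof.
case: r => // r; rewrite /cpow /= rot_size_cat.
by elim: r => [|r IHr] /=; rewrite ?cats0 // -catA IHr.
Qed.

(** Splitting [c] as [u ++ w] with [u] of length [d], invariance says that [u] and [w] commute. Then
    [w], if not empty, begins with [u], and what remains commutes with [u] again, so induction on
    the number of copies applies. *)
Lemma rot_fixed_cpow (T : Type) (c : seq T) r d :
  r * d = size c -> rot d c = c -> c = cpow (take d c) r.
Proof.
have cat_comm u w :
    r * size u = size w -> u ++ w = w ++ u -> w = cpow u r :> seq T.
  elim: r w => [|q IHq] w; first by move/esym/size0nil.
  rewrite mulSn => size_w eq_uw.
  have w_u : take (size u) w = u.
    have := congr1 (take (size u)) eq_uw.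
    by rewrite take_size_cat // takel_cat // -size_w leq_addr.
  rewrite -(cat_take_drop (size u) w) w_u in eq_uw *.
  rewrite {1}[drop _ _]IHq ?size_drop -?size_w ?addKn //.
  by have := congr1 (drop (size u)) eq_uw; rewrite -catA !drop_size_cat.
case: r cat_comm => [_|r cat_comm size_c rot_c].
  by move=> /esym/size0nil ->.
apply: cat_comm.
  by rewrite size_takel // -size_c mulSn leq_addr.
by rewrite -{2}rot_c /rot catA cat_take_drop.
Qed.

(** The condition at a junction of two copies is the condition that closes up [c] itself. *)
Lemma cycle_cpow (T : Type) (e : rel T) (c : seq T) r :
  0 < r -> cycle e (cpow c r) = cycle e c.
Proof.
case: c => [|x p]; first by move=> _; rewrite (_ : cpow [::] r = [::]) //; elim: r.
elim: r => // -[|r] IHr _; first by rewrite /cpow /= cats0.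
rewrite -[in RHS]IHr // /cpow /= -!cat_rcons !rcons_cat !cat_path.
rewrite (rcons_path e x p x) last_rcons.
case: (path e x p) => //=; case: r {IHr} => [|r] /=; first by rewrite andbT andbb.
by rewrite andbA andbb.
Qed.

(** Merging the path and closing conditions into [cycle] makes invariance under rotation and powers
    visible. *)
Lemma is_circuitE n a b (c : seq (bondT n)) :
  is_circuit a b c =
    [&& c != [::], all (is_bond a b) c & cycle (fun e f => e.2 == f.1) c].
Proof. by case: c => //= e s; rewrite rcons_path -andbA. Qed.

Lemma is_circuit_cpow n a b (c : seq (bondT n)) r :
  0 < r -> is_circuit a b (cpow c r) = is_circuit a b c.
Proof.
move=> r_gt0; rewrite !is_circuitE cycle_cpow //.
rewrite -!size_eq0 size_cpow muln_eq0 (negPf (lt0n_neq0 r_gt0)) /=.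
congr [&& _, _ & _]; case: r r_gt0 => // r _; elim: r => [|r IHr].
  by rewrite /cpow /= cats0.
by rewrite -[in RHS]IHr /cpow /= !all_cat andbA andbb.
Qed.

Lemma is_circuit_rot n a b (c : seq (bondT n)) i :
  is_circuit a b (rot i c) = is_circuit a b c.
Proof.
by rewrite !is_circuitE rot_cycle (eq_all_r (mem_rot i c)) -!size_eq0 size_rot.
Qed.

(** * Periodic orbits as classes under rotation *)

(** Rotation is taken as a self-map of the tuples of fixed length, so that [order] is the period and
    [fconnect] the orbit relation. *)
Definition rot1_tuple (T : Type) l (c : l.-tuple T) : l.-tuple T :=
  [tuple of rot 1 c].

Lemma rot1_tuple_inj (T : Type) l : injective (@rot1_tuple T l).
Proof. by move=> c d /(congr1 val) /= /rot_inj /val_inj. Qed.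

Lemma iter_rot1 (T : Type) l (c : l.-tuple T) i :
  i <= l -> val (iter i (@rot1_tuple T l) c) = rot i c.
Proof.
elim: i => [|i IHi] il /=; first by rewrite rot0.
by rewrite IHi 1?ltnW // [RHS]rotS // size_tuple.
Qed.

Lemma iter_rot1_id (T : Type) l (c : l.-tuple T) : iter l (@rot1_tuple T l) c = c.
Proof. by apply: val_inj; rewrite iter_rot1 // rot_oversize ?size_tuple. Qed.

Lemma order_rot1_dvdn (T : finType) l (c : l.-tuple T) :
  order (@rot1_tuple T l) c %| l.
Proof. by rewrite -iter_order_dvdn ?iter_rot1_id //; apply: rot1_tuple_inj. Qed.

Lemma in_orbit_of n l (c d : l.-tuple (bondT n)) : 0 < l ->
  (d \in orbit_of l c) = fconnect (@rot1_tuple _ l) c d.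
Proof.
move=> l_gt0; rewrite inE; apply/existsP/idP => [[i /eqP d_rot] | cd].
  suff -> : d = iter i (@rot1_tuple _ l) c by apply: fconnect_iter.
  by apply: val_inj; rewrite iter_rot1 // ltnW.
(* The number of rotations leading from [c] to [d] is below the period, which divides [l], so it is
   a valid index in ['I_l]. *)
have fi_lt : findex (@rot1_tuple _ l) c d < l.
  by rewrite (leq_trans (findex_max cd)) // dvdn_leq // order_rot1_dvdn.
by exists (Ordinal fi_lt); rewrite -iter_rot1 1?ltnW //= iter_findex.
Qed.

(** A period [o < l] exhibits [c] as the power [l %/ o] of its prefix of length [o]. Conversely, a
    rotation of [cpow c0 r] with [r > 1] is fixed by rotation by [size c0], which is less than
    [l]. *)
Lemma primitive_orbitE n a b l (c : l.-tuple (bondT n)) :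
  0 < l -> is_circuit a b c ->
  `[< primitive_orbit a b (orbit_of l c) >] = (order (@rot1_tuple _ l) c == l).
Proof.
move=> l_gt0 c_circ; set f := @rot1_tuple (bondT n) l.
have f_inj : injective f := @rot1_tuple_inj _ l.
have o_l : order f c %| l := order_rot1_dvdn c.
have o_gt0 := order_gt0 f c.
apply/asboolP/eqP => [c_prim | o_eq [c0 [r [c0_circ [r_gt1 c_pow]]]]].
  apply/eqP; case: eqVneq => // o_neq; case: c_prim.
  have o_lt : order f c < l by rewrite ltn_neqAle o_neq dvdn_leq.
  have c_eq : val c = cpow (take (order f c) c) (l %/ order f c).
    apply: rot_fixed_cpow; first by rewrite divnK // size_tuple.
    by rewrite -iter_rot1 1?ltnW // iter_order.
  have r_gt1 : 1 < l %/ order f c by rewrite ltn_divRL ?mul1n.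
  exists (take (order f c) c), (l %/ order f c); rewrite -c_eq; split=> //.
  by rewrite -(is_circuit_cpow _ _ _ (ltnW r_gt1)) -c_eq.
have: c \in orbit_of l c by rewrite in_orbit_of ?connect0.
rewrite c_pow inE => /existsP[i /eqP c_rot].
have size_c : l = r * size c0.
  by rewrite -(size_tuple c) c_rot size_rot size_cpow.
have c0_l : size c0 <= l by rewrite size_c leq_pmull // ltnW.
have : iter (size c0) f c == c.
  by apply/eqP/val_inj; rewrite iter_rot1 // {1}c_rot rot_rot rot_cpow -c_rot.
rewrite iter_order_dvdn // o_eq => l_c0.
have c0_gt0 : 0 < size c0 by case: (size c0) size_c; lia.
have := dvdn_leq c0_gt0 l_c0; nia.
Qed.

(** The circuits of period [l] form a set closed under rotation; its classes are the primitive
    orbits, and each class has [l] elements. *)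
Lemma card_prim_orbits n a b l : 0 < l ->
  #|[set c : l.-tuple (bondT n) |
       is_circuit a b c && (order (@rot1_tuple _ l) c == l)]|
    = #|prim_orbits n a b l| * l.
Proof.
move=> l_gt0; set D := [set c | _]; set f := @rot1_tuple (bondT n) l.
have f_inj : injective f := @rot1_tuple_inj _ l.
have f_sym := fconnect_sym f_inj.
have D_closed c d : c \in D -> fconnect f c d -> d \in D.
  rewrite !inE => /andP[c_circ /eqP o_c] cd.
  have -> : order f d = order f c.
    by apply: eq_card => y; rewrite !inE (same_connect f_sym cd).
  rewrite o_c eqxx andbT; move: cd; rewrite -in_orbit_of // inE.
  by case/existsP=> i /eqP ->; rewrite is_circuit_rot.
have blockE c : c \in D -> [set d in D | fconnect f c d] = orbit_of l c.
  move=> Dc; apply/setP => d; rewrite inE in_orbit_of //.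
  by have [/(D_closed _ _ Dc) -> | _] := boolP (fconnect f c d); rewrite ?andbF.
have PE : prim_orbits n a b l = equivalence_partition (fconnect f) D.
  apply/setP => p; rewrite inE; apply/andP/imsetP.
    case=> /existsP[c /andP[c_circ /eqP ->]];
      rewrite primitive_orbitE // => o_c.
    have Dc : c \in D by rewrite inE c_circ.
    by exists c; rewrite ?blockE.
  case=> c Dc ->; rewrite blockE //; move: Dc.
  rewrite inE => /andP[c_circ o_c]; rewrite primitive_orbitE //; split=> //.
  by apply/existsP; exists c; rewrite c_circ /=.
rewrite PE; apply: card_uniform_partition.
  move=> _ /imsetP[c Dc ->]; rewrite blockE //; move: Dc.
  rewrite inE => /andP[_ /eqP o_c]; rewrite -[RHS]o_c.
  by apply: eq_card => d; rewrite in_orbit_of.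
apply: equivalence_partitionP => x y z _ _ _; split; first exact: connect0.
by move=> xy; rewrite (same_connect f_sym xy).
Qed.

(** * Möbius inversion over the circuits fixed by rotations *)

(** The [m]-th power is a bijection from the circuits of length [l %/ m] to the fixed ones; its
    inverse takes the prefix of length [l %/ m]. *)
Lemma card_circuits_fixed n a b l m : 0 < l -> m %| l ->
  #|[set c : l.-tuple (bondT n) |
       is_circuit a b c && (iter (l %/ m) (@rot1_tuple _ l) c == c)]|
    = #|[set c : (l %/ m).-tuple (bondT n) | is_circuit a b c]|.
Proof.
move=> l_gt0 m_l; have m_gt0 : 0 < m := dvdn_gt0 l_gt0 m_l.
have pow_tupleP (c : (l %/ m).-tuple (bondT n)) : size (cpow c m) == l.
  by rewrite size_cpow size_tuple mulnC divnK.
pose pow c := Tuple (pow_tupleP c).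
have pow_inj : injective pow.
  move=> c d /(congr1 (take (l %/ m) \o val)) /=.
  have take_pow (e : (l %/ m).-tuple (bondT n)) : take (l %/ m) (cpow e m) = e.
    by have := take_cpow e m_gt0; rewrite size_tuple.
  by rewrite !take_pow => /val_inj.
rewrite -(card_imset _ pow_inj); apply: eq_card => c; rewrite inE.
apply/andP/imsetP => [[c_circ /eqP/(congr1 val)] | [d]].
  rewrite iter_rot1 ?leq_div // => rot_c.
  have c_eq : val c = cpow (take (l %/ m) c) m.
    by apply: rot_fixed_cpow => //; rewrite mulnC divnK // size_tuple.
  have take_tupleP : size (take (l %/ m) c) == l %/ m.
    by rewrite size_takel // size_tuple leq_div.
  exists (Tuple take_tupleP); last exact: val_inj.
  by rewrite inE /= -(is_circuit_cpow _ _ _ m_gt0) -c_eq.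
rewrite inE => d_circ ->; split; first by rewrite /= is_circuit_cpow.
apply/eqP/val_inj; rewrite iter_rot1 ?leq_div //=.
by have := rot_cpow d m; rewrite size_tuple.
Qed.

Lemma prim_orbits_mobius n a b l : 0 < l ->
  ((#|prim_orbits n a b l| * l)%:R =
  \sum_(m <- divisors l)
     mobius m *
     #|[set c : (l %/ m)%N.-tuple (bondT n) | is_circuit a b c]|%:R)%R.
Proof.
move=> l_gt0; rewrite -card_prim_orbits //.
set f := @rot1_tuple (bondT n) l.
have f_inj : injective f := @rot1_tuple_inj _ l.
(* The indicator of period [l] is replaced by a Möbius sum for each circuit; exchanging the sums
   then counts fixed circuits. *)
transitivity (\sum_(c : l.-tuple (bondT n) | is_circuit a b c)
   \sum_(m <- divisors l | iter (l %/ m)%N f c == c) mobius m)%R.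
  rewrite -sum1dep_card natr_sum big_mkcondr; apply: eq_bigr => c _.
  by rewrite sum_mobius_fixed ?iter_rot1_id //; case: (_ == l).
rewrite (exchange_big_dep predT) //= [LHS]big_seq [RHS]big_seq.
apply: eq_bigr => m; rewrite -dvdn_divisors // => m_l.
rewrite -card_circuits_fixed // -sum1dep_card natr_sum mulr_sumr.
by apply: eq_bigr => c _; rewrite mulr1.
Qed.

(** * Circuits as a starting vertex with a word in the two steps *)

(** A Boolean word is the indicator of the set of its true positions. *)
Lemma card_tuple_count l k :
  #|[set w : l.-tuple bool | count id w == k]| = 'C(l, k).
Proof.
rewrite -[in RHS](card_ord l) -card_draws.
pose g (A : {set 'I_l}) := [tuple i \in A | i < l].
have g_inj : injective g.
  move=> A B gAB; apply/setP => i; have := congr1 (fun t => tnth t i) gAB.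
  by rewrite !tnth_mktuple.
rewrite -(card_imset _ g_inj); apply: eq_card => w; rewrite inE.
have count_g A : count id (g A) = #|A|.
  by rewrite /= count_map -size_filter cardE [in RHS]/enum_mem -enumT.
apply/idP/imsetP => [/eqP w_k | [A]]; last first.
  by rewrite inE => /eqP <- ->; rewrite count_g.
exists [set i | tnth w i].
  rewrite inE -count_g -w_k; apply/eqP; congr (count _ _); congr val.
  by apply: eq_from_tnth => i; rewrite tnth_mktuple inE.
by apply: eq_from_tnth => i; rewrite tnth_mktuple inE.
Qed.

Section Trace.
Variables (n a b : nat).

(** Throughout the section the modulus is [n.+1], so that ['I_n.+1] is an additive group; the letter
    [true] stands for a step [b]. *)
Definition step (x : bool) : 'I_n.+1 := inZp (if x then b else a).

Fixpoint trace (v : 'I_n.+1) (w : seq bool) : seq (bondT n.+1) :=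
  if w is x :: w' then (v, v + step x)%R :: trace (v + step x)%R w' else [::].

Definition is_long (e : bondT n.+1) : bool := e.2 == (e.1 + step true)%R.

Lemma is_bondE (e : bondT n.+1) :
  is_bond a b e = (e.2 == (e.1 + step (is_long e))%R).
Proof.
have stepE x : (val e.2 == (val e.1 + if x then b else a) %% n.+1)
             = (e.2 == (e.1 + step x)%R).
  by rewrite -val_eqE /= modnDmr.
rewrite /is_bond (stepE false) (stepE true) -/(is_long e).
case: (boolP (is_long e)) => [e_long | _]; last by rewrite orbF.
by rewrite orbT -/(is_long e) e_long.
Qed.

Lemma size_trace v w : size (trace v w) = size w.
Proof. by elim: w v => //= x w IHw v; rewrite IHw. Qed.

Lemma map_is_long_trace v w : step false != step true ->
  map is_long (trace v w) = w.
Proof.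
move=> ab; elim: w v => //= x w IHw v; rewrite IHw; congr cons.
by rewrite /is_long /= (inj_eq (addrI v)); case: x; rewrite ?eqxx // (negPf ab).
Qed.

Lemma all_is_bond_trace v w : all (is_bond a b) (trace v w).
Proof.
elim: w v => //= x w IHw v; rewrite IHw andbT /is_bond /=.
by rewrite !modnDmr; case: x; rewrite eqxx ?orbT.
Qed.

Lemma path_trace e w :
  path (fun e f : bondT n.+1 => e.2 == f.1) e (trace e.2 w).
Proof. by elim: w e => //= x w IHw e; rewrite eqxx; apply: (IHw (_, _)). Qed.

Lemma last_trace e w :
  (last e (trace e.2 w)).2 = (e.2 + \sum_(x <- w) step x)%R.
Proof.
elim: w e => [|x w IHw] e /=; first by rewrite big_nil addr0.
by rewrite (IHw (_, _)) big_cons /= addrA.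
Qed.

(** The preceding bond [e] serves to supply the starting vertex [e.2]; from there each bond is
    determined by its origin and its letter. *)
Lemma trace_of_path e (c : seq (bondT n.+1)) :
  all (is_bond a b) c -> path (fun e f : bondT n.+1 => e.2 == f.1) e c ->
  c = trace e.2 (map is_long c).
Proof.
elim: c e => //= f c IHc e /andP[f_bond c_bond] /andP[/eqP ef fc].
rewrite ef; move: f_bond; rewrite is_bondE => /eqP <-.
by rewrite -(IHc f) //; case: (f).
Qed.

Lemma val_sum_step w :
  val (\sum_(x <- w) step x)%R
    = ((size w - count id w) * a + count id w * b) %% n.+1.
Proof.
elim: w => [|x w IHw]; first by rewrite big_nil mod0n.
rewrite big_cons /= IHw modnDml modnDmr; congr (_ %% _).
have := count_size id w; case: x => /= cw; first by rewrite !add1n subSS; lia.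
by rewrite add0n subSn //; lia.
Qed.

(** A trace is always a path of bonds, so only closure matters: the total displacement, [(l - k) * a
    + k * b = l * a + k * (b - a)] for a word of length [l] with [k] letters [true], must vanish
    modulo [n.+1]. *)
Lemma is_circuit_trace v w : a < b -> 0 < size w ->
  is_circuit a b (trace v w) =
    (n.+1 %| size w * a + count id w * (b - a)).
Proof.
case: w => // x w ab _.
rewrite [LHS]/= -/(trace v (x :: w)) -[_ && all _ _]/(all _ (trace v (x :: w))).
rewrite all_is_bond_trace (path_trace (v, _)) (last_trace (v, _)) /=.
rewrite -addrA -[X in _ == X]addr0 (inj_eq (addrI v)).
have := val_sum_step (x :: w); rewrite big_cons => sumE.
rewrite -val_eqE sumE -/(dvdn _ _) /=; congr (_ %| _).
have := count_size id (x :: w); rewrite /=; nia.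
Qed.

Lemma trace_of_circuit e s : is_circuit a b (e :: s) ->
  e :: s = trace e.1 (map is_long (e :: s)).
Proof.
case/andP=> /andP[/andP[e_bond s_bond] e_s] _ /=.
move: e_bond; rewrite is_bondE => /eqP <-.
by rewrite -(trace_of_path s_bond e_s); case: (e).
Qed.

End Trace.

(** Since [a < b < n], the two steps differ modulo [n], so a circuit determines its word. Closure
    depends only on the number [k] of long steps, and every starting vertex is allowed, whence the
    factor [n]. *)
Lemma card_circuits n a b l : a < b -> b < n -> 0 < l ->
  #|[set c : l.-tuple (bondT n) | is_circuit a b c]|
    = n * \sum_(k < l.+1 | n %| l * a + k * (b - a)) 'C(l, k).
Proof.
case: n => // n ab bn l_gt0.
have step_neq : step n a b false != step n a b true.
  by rewrite -val_eqE /= !modn_small //; lia.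
(* The default tuple is never reached, since the trace of a word of length [l] has length [l]. *)
pose tr (vw : 'I_n.+1 * l.-tuple bool) : l.-tuple (bondT n.+1) :=
  insubd [tuple of nseq l (ord0, ord0)] (trace a b vw.1 vw.2).
have val_tr vw : val (tr vw) = trace a b vw.1 vw.2.
  by rewrite val_insubd size_trace size_tuple eqxx.
have tr_inj : injective tr.
  move=> [v w] [v' w'] /(congr1 val); rewrite !val_tr /= => tr_eq.
  have ww' : w = w'.
    apply: val_inj; rewrite /= -(map_is_long_trace v w step_neq) tr_eq.
    by rewrite map_is_long_trace.
  (* As [l] is positive there is a first bond, whose origin gives back the starting vertex. *)
  move: tr_eq; rewrite -ww'; case: l w {tr val_tr w' ww'} l_gt0 => // l w _.
  by case/tupleP: w => x w /= [->].
pose W := [set w : l.-tuple bool | n.+1 %| l * a + count id w * (b - a)].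
have head_tr (c : l.-tuple (bondT n.+1)) : is_circuit a b c ->
    exists v, val c = trace a b v (map (is_long a b) c).
  case: c => -[|e s] // sz_c c_circ; exists e.1; exact: trace_of_circuit.
transitivity #|tr @: setX setT W|.
  apply: eq_card => c; rewrite inE; apply/idP/imsetP => [c_circ | [[v w]]].
    have [v c_tr] := head_tr c c_circ.
    exists (v, [tuple of map (is_long a b) c]); last first.
      by apply: val_inj; rewrite val_tr.
    rewrite !inE /=; move: c_circ; rewrite c_tr is_circuit_trace //.
      by rewrite size_map size_tuple map_is_long_trace.
    by rewrite size_map size_tuple.
  by rewrite !inE /= => w_W ->; rewrite val_tr is_circuit_trace ?size_tuple.
rewrite card_imset // cardsX cardsT card_ord; congr (_ * _).
have count_lt (w : l.-tuple bool) : count id w < l.+1.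
  by rewrite ltnS -[X in _ <= X](size_tuple w) count_size.
rewrite -sum1dep_card (partition_big
  (fun w : l.-tuple bool => inord (count id w) : 'I_l.+1)
  (fun k : 'I_l.+1 => n.+1 %| l * a + k * (b - a))) /=; last first.
  by move=> w; rewrite inordK.
apply: eq_bigr => k k_n; rewrite sum1dep_card -card_tuple_count.
apply: eq_card => w.
rewrite !inE -val_eqE /= inordK //.
by case: eqP => [-> | _]; rewrite ?k_n ?andbF.
Qed.

(** * Binomials with rational arguments and winding numbers *)

Lemma is_natQ_nat N : is_natQ N%:R.
Proof. by rewrite /is_natQ pmulrn denq_int numq_int eqxx. Qed.

Lemma is_natQP (x : rat) : is_natQ x -> exists N : nat, x = N%:R%R.
Proof.
case/andP=> /eqP x_int x_ge0; exists (absz (numq x)).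
by rewrite pmulrn gez0_abs // numqE x_int mulr1.
Qed.

Lemma binomQ_nat N K : binomQ N%:R K%:R = 'C(N, K).
Proof. by rewrite /binomQ !is_natQ_nat !pmulrn !numq_int. Qed.

Lemma k_omegaE n a b l w m K : a < b -> 0 < m ->
  (k_omega n a b l w / m%:R == K%:R)%R = (w * n == l * a + m * K * (b - a)).
Proof.
move=> ab m_gt0; rewrite /k_omega -(natrB _ (ltnW ab)).
have m_neq0 : (m%:R != 0 :> rat)%R by rewrite pnatr_eq0 -lt0n.
have ba_neq0 : ((b - a)%N%:R != 0 :> rat)%R.
  by rewrite pnatr_eq0 subn_eq0 -ltnNge.
rewrite (can2_eq (divfK m_neq0) (mulfK m_neq0)).
rewrite (can2_eq (divfK ba_neq0) (mulfK ba_neq0)) subr_eq.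
by rewrite -!natrM -natrD eqr_nat addnC (mulnC K).
Qed.

(** The binomial becomes a sum with at most one term, so that the convention of value 0 is an empty
    sum. An integer lower argument beyond [l %/ m] also gives 0 on both sides. *)
Lemma binomQ_k_omega n a b l w m : a < b -> 0 < m ->
  binomQ (l%:R / m%:R)%R (k_omega n a b l w / m%:R)%R =
  \sum_(k < (l %/ m).+1 | (m %| l) && (w * n == l * a + m * k * (b - a)))
     'C(l %/ m, k).
Proof.
move=> ab m_gt0; have m_neq0 : (m%:R != 0 :> rat)%R by rewrite pnatr_eq0 -lt0n.
have quotE : m %| l -> (l%:R / m%:R)%R = (l %/ m)%:R%R :> rat.
  by case/dvdnP=> q ->; rewrite mulnK // natrM mulfK.
have [/andP[/is_natQP[N lm] /is_natQP[K km]] | not_nat] :=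
  boolP (is_natQ (l%:R / m%:R)%R && is_natQ (k_omega n a b l w / m%:R)%R).
  have m_l : m %| l.
    apply/dvdnP; exists N; apply/eqP; rewrite -(eqr_nat rat) natrM -lm.
    by rewrite divfK.
  move/eqP: (km); rewrite k_omegaE // => /eqP wn.
  rewrite km quotE // binomQ_nat m_l /= wn.
  have eqK k : (l * a + m * K * (b - a) == l * a + m * k * (b - a)) = (k == K).
    by rewrite eqn_add2l eqn_pmul2r ?subn_gt0 // eqn_pmul2l // eq_sym.
  under eq_bigl => k do rewrite eqK.
  have [K_le | K_gt] := leqP K (l %/ m).
    by rewrite (big_pred1 (Ordinal (K_le : K < _.+1))).
  rewrite bin_small // big1 // => k /eqP kK.
  by have := ltn_ord k; rewrite kK ltnS leqNgt K_gt.
rewrite /binomQ (negPf not_nat) big1 // => k /andP[m_l].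
rewrite -k_omegaE // => /eqP kE; case/negP: not_nat.
by rewrite quotE // kE !is_natQ_nat.
Qed.

(** With [t] the displacement of a word of length [l %/ m], the equation reads [w * n = m * t]. For
    [w = m * q] it becomes [q * n = t], which has one solution or none according to whether [n]
    divides [t]. *)
Lemma sum_winding1 n a b l m k : 0 < n -> a < b -> m %| l -> 0 < m ->
  k <= l %/ m ->
  \sum_(ceil_div (l * a) n <= w < ((l * b) %/ n).+1
          | (m %| w) && (w * n == l * a + m * k * (b - a))) 1
    = (n %| (l %/ m) * a + k * (b - a)).
Proof.
move=> n_gt0 ab m_l m_gt0 k_le.
set t := (l %/ m) * a + k * (b - a).
have mt : l * a + m * k * (b - a) = m * t.
  by rewrite /t -{1}(divnK m_l); lia.
have mk_le : m * k <= l by rewrite -(divnK m_l) mulnC leq_mul2r k_le orbT.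
(* These two bounds place the solution [w] inside the range of summation. *)
have mt_ge : l * a <= m * t by rewrite -mt leq_addr.
have mt_le : m * t <= l * b.
  by rewrite -mt -{2}(subnKC (ltnW ab)) mulnDr leq_add2l leq_mul2r mk_le orbT.
rewrite mt; case: (boolP (n %| t)) => [/dvdnP[q tE] | n_t].
  rewrite (eq_bigl (pred1 (m * q))) => [|w] /=; last first.
    rewrite tE mulnA eqn_pmul2r //.
    by case: eqVneq => [-> | _]; rewrite ?andbF ?dvdn_mulr.
  rewrite -big_filter filter_pred1_uniq ?iota_uniq ?big_seq1 // mem_index_iota.
  (* For the rounded-up lower limit, [ceil_div (l * a) n <= w] amounts to [l * a <= w * n]. *)
  rewrite ltnS leq_divRL // /ceil_div -mulnA -tE mt_le andbT.
  rewrite -ltnS ltn_divLR // mulSn -mulnA -tE; lia.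
rewrite big1 // => w /andP[/dvdnP[q ->] /eqP].
rewrite [q * m]mulnC -mulnA => /eqP; rewrite eqn_pmul2l // => /eqP tE.
by rewrite -tE dvdn_mull in n_t.
Qed.

Lemma sum_winding_binomial n a b l m : 0 < n -> a < b -> 0 < m -> m %| l ->
  \sum_(ceil_div (l * a) n <= w < ((l * b) %/ n).+1 | m %| w)
     \sum_(k < (l %/ m).+1 | w * n == l * a + m * k * (b - a)) 'C(l %/ m, k)
    = \sum_(k < (l %/ m).+1 | n %| (l %/ m) * a + k * (b - a)) 'C(l %/ m, k).
Proof.
move=> n_gt0 ab m_gt0 m_l.
rewrite (exchange_big_dep predT) //= [RHS]big_mkcond; apply: eq_bigr => k _.
rewrite -[X in \sum_(_ <= _ < _ | _) X]mul1n -big_distrl /=.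
rewrite sum_winding1 //; last by rewrite -ltnS.
by case: (n %| _); rewrite ?mul1n.
Qed.

(** * Exchange of the sums over divisors and winding numbers *)

Local Open Scope ring_scope.

Theorem theorem2 (n a b l : nat) :
  (2 <= n)%N -> (0 < a)%N -> (a < b)%N -> (b < n)%N ->
  gcdn (gcdn n a) b = 1%N -> (1 <= l)%N ->
  (#|prim_orbits n a b l|)%:R = prim_count_formula n a b l :> rat.
Proof.
move=> n_ge2 a_gt0 ab bn _ l_gt0.
have n_gt0 : (0 < n)%N by lia.
have l_neq0 : (l%:R != 0 :> rat)%R by rewrite pnatr_eq0 -lt0n.
apply: (mulIf l_neq0); rewrite /prim_count_formula mulrAC divfK //.
rewrite -natrM -[LHS](rmorph_nat (intr : int -> rat)) prim_orbits_mobius //.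
rewrite rmorph_sum /=.
transitivity (n%:R * \sum_(m <- divisors l) (mobius m)%:~R *
   (\sum_(k < (l %/ m).+1 | (n %| (l %/ m) * a + k * (b - a))%N)
       'C(l %/ m, k))%:R
   : rat)%R.
  rewrite mulr_sumr [LHS]big_seq [RHS]big_seq; apply: eq_bigr => m.
  rewrite -dvdn_divisors // => m_l; have m_gt0 := dvdn_gt0 l_gt0 m_l.
  have lm_gt0 : (0 < l %/ m)%N by rewrite divn_gt0 // dvdn_leq.
  rewrite (card_circuits ab bn lm_gt0).
  by rewrite rmorphM /= rmorph_nat natrM mulrCA.
congr (_ * _)%R.
(* Positivity of [a] and [l] keeps [w = 0] out of the range, so membership in [divisors w] does mean
   dividing [w]. *)
have w_gt0 w : (ceil_div (l * a) n <= w)%N -> (0 < w)%N.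
  by apply: leq_trans; rewrite /ceil_div divn_gt0 //; nia.
transitivity (\sum_(m <- divisors l)
   \sum_(ceil_div (l * a) n <= w < ((l * b) %/ n).+1 | (m %| w)%N)
     (mobius m)%:~R * (\sum_(k < (l %/ m).+1 |
        (w * n == l * a + m * k * (b - a))%N) 'C(l %/ m, k))%:R : rat)%R.
  rewrite [LHS]big_seq [RHS]big_seq; apply: eq_bigr => m.
  rewrite -dvdn_divisors // => m_l.
  rewrite -mulr_sumr -natr_sum sum_winding_binomial //.
  exact: dvdn_gt0 m_l.
rewrite (exchange_big_dep predT) //= big_nat_cond [RHS]big_nat_cond.
apply: eq_bigr => w /andP[/andP[/w_gt0 {}w_gt0 _] _].
(* The exchange leaves the common divisors of [l] and [w]. The sum extends to all divisors of [w],
   because the binomial is 0 when [l / m] is not an integer. *)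
have gcd_divisors : perm_eq [seq m <- divisors l | (m %| w)%N]
    [seq m <- divisors w | (m %| l)%N].
  apply: uniq_perm; rewrite ?filter_uniq ?divisors_uniq // => m.
  by rewrite !mem_filter -!dvdn_divisors // andbC.
rewrite -big_filter (perm_big _ gcd_divisors) /= big_filter big_mkcond.
rewrite [LHS]big_seq [RHS]big_seq; apply: eq_bigr => m.
rewrite -dvdn_divisors // => /(dvdn_gt0 w_gt0) m_gt0.
rewrite binomQ_k_omega //; case: (m %| l)%N => //.
by rewrite big_pred0 ?mulr0.
Qed.
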